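(* Suppose that the set $\mathcal{T}(x)=\{y\in\mathbb{R}^{n_y}: Dy\le b-Cx,\ \underline{y}\le y\le\bar{y}\}$ is nonempty for all $x\in B(\underline{x},\bar{x})$. Then there exists $L>0$ such that for any $x,\tilde{x}\in B(\underline{x},\bar{x})$ it holds $$|\varphi(\tilde{x})-\varphi(x)|\le L\,\|\tilde{x}-x\|.$$
   Context: Let $C\in\mathbb{R}^{m_l\times n_x}$, $D\in\mathbb{R}^{m_l\times n_y}$, $b\in\mathbb{R}^{m_l}$, $d_l\in\mathbb{R}^{n_y}$, and let $G_l\in\mathbb{R}^{n_y\times n_y}$ be a symmetric, possibly indefinite matrix. Let $\underline{x}\le\bar{x}$ in $\mathbb{R}^{n_x}$ and $\underline{y}\le\bar{y}$ in $\mathbb{R}^{n_y}$ be finite bounds and $B(\underline{x},\bar{x})=\{x\in\mathbb{R}^{n_x}:\underline{x}\le x\le\bar{x}\}$. The optimal-value function of the ($x$-parameterized, nonconvex quadratic) lower-level problem is $$\varphi(x)=\min_{\tilde{y}}\left\{\tfrac12\tilde{y}^\top G_l\tilde{y}+d_l^\top\tilde{y} : Cx+D\tilde{y}\le b,\ \underline{y}\le\tilde{y}\le\bar{y},\ \tilde{y}\in\mathbb{R}^{n_y}\right\}.$$ *)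

(* Defs.v *)
From HB Require Import structures.
From mathcomp Require Import all_boot all_order all_algebra.
From mathcomp Require Import all_classical all_reals all_analysis.

Set Implicit Arguments.
Unset Strict Implicit.
Unset Printing Implicit Defensive.

Import Order.TTheory GRing.Theory Num.Theory.
Import numFieldNormedType.Exports.

Local Open Scope classical_set_scope.
Local Open Scope ring_scope.

Definition vle (R : realType) (n : nat) (u v : 'cV[R]_n) : Prop :=
  forall i : 'I_n, u i 0 <= v i 0.

(* Euclidean norm; the library norm `|u| on matrices is the max norm. *)
Definition enorm (R : realType) (n : nat) (u : 'cV[R]_n) : R :=
  Num.sqrt (\sum_(i < n) u i 0 ^+ 2).

Definition box (R : realType) (n : nat) (l u : 'cV[R]_n) : set 'cV[R]_n :=
  [set x | vle l x /\ vle x u].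

Definition lower_objective (R : realType) (ny : nat)
    (G : 'M[R]_ny) (d y : 'cV[R]_ny) : R :=
  2^-1 * (y^T *m G *m y) 0 0 + (d^T *m y) 0 0.

Definition lower_feasible (R : realType) (ml nx ny : nat)
    (C : 'M[R]_(ml, nx)) (D : 'M[R]_(ml, ny)) (b : 'cV[R]_ml)
    (yl yu : 'cV[R]_ny) (x : 'cV[R]_nx) : set 'cV[R]_ny :=
  [set y | vle (C *m x + D *m y) b /\ vle yl y /\ vle y yu].

Definition Tset (R : realType) (ml nx ny : nat)
    (C : 'M[R]_(ml, nx)) (D : 'M[R]_(ml, ny)) (b : 'cV[R]_ml)
    (yl yu : 'cV[R]_ny) (x : 'cV[R]_nx) : set 'cV[R]_ny :=
  [set y | vle (D *m y) (b - C *m x) /\ vle yl y /\ vle y yu].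

(* At most a singleton. *)
Definition minimums (R : realType) (A : set R) : set R := A `&` lbound A.

(* The default value 0 is returned only when there is no minimum; by
   [phi_is_minimum] this happens only for infeasible problems. *)
Definition phi (R : realType) (ml nx ny : nat)
    (C : 'M[R]_(ml, nx)) (D : 'M[R]_(ml, ny)) (b : 'cV[R]_ml)
    (G : 'M[R]_ny) (d : 'cV[R]_ny) (yl yu : 'cV[R]_ny) (x : 'cV[R]_nx) : R :=
  xget 0 (minimums (lower_objective G d @` lower_feasible C D b yl yu x)).

Lemma TsetE (R : realType) (ml nx ny : nat)
    (C : 'M[R]_(ml, nx)) (D : 'M[R]_(ml, ny)) (b : 'cV[R]_ml)
    (yl yu : 'cV[R]_ny) (x : 'cV[R]_nx) :
  Tset C D b yl yu x = lower_feasible C D b yl yu x.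
Proof.
apply/seteqP; split => y [h1 h2]; split => // i; have := h1 i;
  by rewrite !mxE lerBrDl.
Qed.

Lemma phi_is_minimum (R : realType) (ml nx ny : nat)
    (C : 'M[R]_(ml, nx)) (D : 'M[R]_(ml, ny)) (b : 'cV[R]_ml)
    (G : 'M[R]_ny) (d : 'cV[R]_ny) (yl yu : 'cV[R]_ny) (x : 'cV[R]_nx) :
  Tset C D b yl yu x !=set0 ->
  minimums (lower_objective G d @` lower_feasible C D b yl yu x)
    (phi C D b G d yl yu x).
Proof.
rewrite TsetE => -[y0 y0F].
pose A : set 'rV[R]_ny := [set u | lower_feasible C D b yl yu x u^T].
have csum (f : 'I_ny -> 'rV[R]_ny -> R) :
    (forall j, continuous (f j)) -> continuous (fun v => \sum_j f j v).
  by move=> h; apply: continuous_big => [|j _]; [exact: add_continuous|exact: h].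
have cmul (f g : 'rV[R]_ny -> R) : continuous f -> continuous g ->
    continuous (fun v => f v * g v).
  by move=> cf cg u; exact: (@continuousM _ _ f g u (cf u) (cg u)).
have ccst (c : R) : continuous (fun _ : 'rV[R]_ny => c) by exact: cst_continuous.
have ccoord (j : 'I_ny) : continuous (fun v : 'rV[R]_ny => v 0 j).
  exact: coord_continuous.
have cM p (E : 'M[R]_(p, ny)) k : continuous (fun v : 'rV[R]_ny => (E *m v^T) k 0).
  rewrite (_ : (fun v => _) = (fun v : 'rV[R]_ny => \sum_j E k j * v 0 j)).
    by apply: csum => j; apply: cmul.
  by apply/funext => v; rewrite mxE; apply: eq_bigr => j _; rewrite mxE.
have cobj : continuous (fun v : 'rV[R]_ny => lower_objective G d v^T).
  have cq : continuous (fun v : 'rV[R]_ny => (v^T^T *m G *m v^T) 0 0).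
    rewrite (_ : (fun v => _) =
      (fun v : 'rV[R]_ny => \sum_j v 0 j * (G *m v^T) j 0)).
      by apply: csum => j; apply: cmul.
    apply/funext => v.
    by rewrite -mulmxA mxE; apply: eq_bigr => j _; rewrite trmxK.
  move=> u; rewrite /lower_objective.
  exact: (@continuousD _ R _ _ _ u (cmul _ _ (ccst _) cq u) (cM _ _ _ u)).
have cA : compact A.
  rewrite (_ : A = [set u | vle (C *m x + D *m u^T) b] `&`
      [set u : 'rV[R]_ny | forall i, `[yl i 0, yu i 0]%classic (u 0 i)]); last first.
    apply/seteqP; split => u /=.
      move=> [h1 [h2 h3]]; split => // i; rewrite in_itv /=.
      by have := h2 i; have := h3 i; rewrite !mxE => -> ->.
    move=> [h1 h2]; split => //; split => i; have := h2 i;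
      by rewrite in_itv /= !mxE => /andP[].
  rewrite setIC; apply: compact_closedI.
    by apply: (@rV_compact _ _ (fun i => `[yl i 0, yu i 0]%classic)) => i;
      exact: segment_compact.
  rewrite (_ : [set u | _] =
      \bigcap_(k in [set: 'I_ml])
        ((fun u : 'rV[R]_ny => (D *m u^T) k 0) @^-1`
         [set t | t <= b k 0 - (C *m x) k 0])); last first.
    apply/seteqP; split => u /=.
      by move=> h k _; rewrite /= lerBrDl; have := h k; rewrite mxE.
    by move=> h k; have := h k I; rewrite /= lerBrDl [in X in _ -> X]mxE.
  apply: closed_bigI => k _; apply: closed_comp; last exact: closed_le.
  by move=> u _; exact: cM.
have [||c [Ac mc]] := @compact_EVT_min _ R
    (fun v : 'rV[R]_ny => lower_objective G d v^T) A _ cA.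
- by exists y0^T; rewrite /A /= trmxK.
- exact: continuous_subspaceT.
rewrite /phi; apply: (@xgetPex _ 0).
exists (lower_objective G d c^T); split; first by exists c^T => //; exact/set_mem.
move=> _ [y yF <-].
have -> : y = y^T^T by rewrite trmxK.
by apply: mc; apply/mem_set; rewrite /A /= trmxK.
Qed.

(* Main.v *)
Require Import Defs.
From HB Require Import structures.
From mathcomp Require Import all_boot all_order all_algebra.
From mathcomp Require Import all_classical all_reals all_analysis.
From mathcomp Require Import ring lra.

(** The feasible set of the lower-level problem is a polyhedron in [y] whose
    coefficient matrix is fixed and whose right-hand side moves affinely with
    [x].  Such a polyhedron is a Lipschitz function of its right-hand side, by
    Hoffman's error bound ([hoffman_bound]): a point violating each constraint
    by at most [e] lies within [K * e] of the feasible set, as soon as that set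
    is nonempty, with [K] depending on the coefficients only.  Hence a
    minimizer [y] for [x] has a point [y'] feasible for [x'] at distance
    [O(enorm (x' - x))] ([lower_feasible_lipschitz]).  All feasible points lie
    in the compact box [yl, yu], where the quadratic objective is Lipschitz
    ([lower_objective_lipschitz]), so the value at [x'] exceeds the value at
    [x] by at most [O(enorm (x' - x))]; exchanging [x] and [x'] concludes.

    Hoffman's bound is proved by Fourier-Motzkin elimination, which avoids
    duality.  Eliminating one variable [t] turns a system with slack [e] into a
    system in one variable fewer with slack proportional to [e], to which
    induction applies and gives a nearby feasible [u'].  The constraints on
    [t], taken at [u'], are then finitely many lower and upper bounds, each
    lower one below each upper one, which the old value of [t] satisfies up to
    [O(e)]; so moving [t] by [O(e)] satisfies them ([between_finite_bounds]). *)

Set Implicit Arguments.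
Unset Strict Implicit.
Unset Printing Implicit Defensive.

Import Order.TTheory GRing.Theory Num.Theory.
Import numFieldNormedType.Exports.

Local Open Scope classical_set_scope.
Local Open Scope ring_scope.

(** * Hoffman's error bound by Fourier-Motzkin elimination *)

(** Hoffman's bound on a line, where feasibility is expressed as in Helly's
    theorem: pairwise compatibility of the lower and upper bounds suffices. *)
Lemma between_finite_bounds (R : realFieldType) (I : finType) (P N : pred I)
    (lo hi : I -> R) (t e : R) :
  0 <= e ->
  (forall i k, P i -> N k -> lo k <= hi i) ->
  (forall i, P i -> t - e <= hi i) ->
  (forall k, N k -> lo k <= t + e) ->
  exists t', [/\ forall i, P i -> t' <= hi i,
                 forall k, N k -> lo k <= t' & `|t' - t| <= e].
Proof.
move=> e0 lohi thi lot.
(* Starting the maximum at [t - e] makes this the least admissible point that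
   is not further than [e] to the left of [t]. *)
exists (\big[Num.max/t - e]_(k | N k) lo k); split.
- by move=> i Pi; apply: bigmax_le => [|k Nk]; [exact: thi | exact: lohi].
- by move=> k Nk; apply: le_bigmax_cond.
- have h1 : t - e <= \big[Num.max/t - e]_(k | N k) lo k by apply: bigmax_ge_id.
  have h2 : \big[Num.max/t - e]_(k | N k) lo k <= t + e.
    by apply: bigmax_le => [|k Nk]; [lra | exact: lot].
  by rewrite ler_norml; lra.
Qed.

Lemma sum_mul_le (R : realFieldType) (n : nat) (a h : 'I_n -> R) (e : R) :
  (forall j, `|h j| <= e) ->
  `|\sum_(j < n) a j * h j| <= (\sum_(j < n) `|a j|) * e.
Proof.
move=> he; apply: le_trans (ler_norm_sum _ _ _) _.
rewrite mulr_suml; apply: ler_sum => j _.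
by rewrite normrM ler_wpM2l.
Qed.

(** The constant [K] is chosen before the right-hand side [r]; this uniformity
    is what turns the bound into Lipschitz continuity in [r].  The index type
    of the constraints varies in the induction, since elimination replaces [I]
    by [I + I * I]. *)
Lemma hoffman_bound (R : realFieldType) (n : nat) :
  forall (I : finType) (a : I -> 'I_n -> R),
  exists2 K : R, 0 <= K &
    forall (r : I -> R) (y : 'I_n -> R) (e : R), 0 <= e ->
      (exists z : 'I_n -> R, forall i, \sum_(j < n) a i j * z j <= r i) ->
      (forall i, \sum_(j < n) a i j * y j <= r i + e) ->
      exists y' : 'I_n -> R,
        (forall i, \sum_(j < n) a i j * y' j <= r i) /\
        (forall j, `|y' j - y j| <= K * e).
Proof.
elim: n => [|n IHn] I a.
  exists 0 => // r y e _ [z zr] _; exists y; split=> [i|[]//].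
  by move: (zr i); rewrite !big_ord0.
pose s i := a i ord0.
pose c i j := a i (lift ord0 j).
have splitE i (y : 'I_n.+1 -> R) : \sum_(j < n.+1) a i j * y j =
    s i * y ord0 + \sum_(j < n) c i j * y (lift ord0 j).
  by rewrite big_ord_recl.
(* The eliminated system: [inl i] keeps a row free of the first variable, and
   [inr (i, k)] states that the lower bound given by row [k] is below the upper
   bound given by row [i]; the other indices carry the trivial row [0 <= 0]. *)
pose up_lo p := (0 < s p.1) && (s p.2 < 0).
pose a1 (q : I + I * I) (j : 'I_n) : R := match q with
  | inl i => if s i == 0 then c i j else 0
  | inr p => if up_lo p then (s p.1)^-1 * c p.1 j - (s p.2)^-1 * c p.2 j else 0
  end.
pose r1 (r : I -> R) (q : I + I * I) : R := match q with
  | inl i => if s i == 0 then r i else 0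
  | inr p => if up_lo p then (s p.1)^-1 * r p.1 - (s p.2)^-1 * r p.2 else 0
  end.
have row_inl i u : s i = 0 ->
    \sum_(j < n) a1 (inl i) j * u j = \sum_(j < n) c i j * u j.
  by move=> si; rewrite /a1 si eqxx.
have row_inr p u : up_lo p -> \sum_(j < n) a1 (inr p) j * u j =
    (s p.1)^-1 * (\sum_(j < n) c p.1 j * u j)
    - (s p.2)^-1 * (\sum_(j < n) c p.2 j * u j).
  move=> hp; rewrite /a1 hp !mulr_sumr -sumrB.
  by apply: eq_bigr => j _; ring.
have [K1 K1_ge0 hK1] := IHn _ a1.
pose S := \sum_i `|s i|^-1.
have S_ge0 : 0 <= S by apply: sumr_ge0 => i _; rewrite invr_ge0.
have leS i : `|s i|^-1 <= S.
  by rewrite /S (bigD1 i) //= lerDl sumr_ge0 // => k _; rewrite invr_ge0.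
pose M := \sum_i \sum_(j < n) `|c i j|.
have M_ge0 : 0 <= M by do 2!apply: sumr_ge0 => ? _.
have leM i : \sum_(j < n) `|c i j| <= M.
  rewrite /M (bigD1 i) //= lerDl; do 2!apply: sumr_ge0 => ? _.
  exact: normr_ge0.
(* With slack [e] in the given system, the eliminated one has slack
   [(1 + 2 * S) * e], the coordinates other than the first move by [k1 * e],
   and the first one by [k2 * e]. *)
pose k1 := K1 * (1 + 2 * S).
have k1_ge0 : 0 <= k1 by rewrite mulr_ge0 //; lra.
pose k2 := S * (1 + M * k1).
have k2_ge0 : 0 <= k2 by rewrite !mulr_ge0 // addr_ge0 // mulr_ge0.
have elim_slack (r : I -> R) (y : 'I_n.+1 -> R) e q : 0 <= e ->
    (forall i, \sum_(j < n.+1) a i j * y j <= r i + e) ->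
    \sum_(j < n) a1 q j * y (lift ord0 j) <= r1 r q + (1 + 2 * S) * e.
  move=> e0 yr.
  have slack_ge0 : 0 <= (1 + 2 * S) * e by rewrite mulr_ge0 //; lra.
  have Se : 0 <= S * e by rewrite mulr_ge0.
  case: q => [i|p].
    have [si|si] := eqVneq (s i) 0.
      rewrite row_inl // /r1 si eqxx.
      by have := yr i; rewrite splitE si mul0r add0r => /le_trans; apply; lra.
    rewrite big1 => [|j _]; first by rewrite /r1 (negbTE si) add0r.
    by rewrite /a1 (negbTE si) mul0r.
  have [hp|/negbTE hp] := boolP (up_lo p); last first.
    rewrite big1 => [|j _]; first by rewrite /r1 hp add0r.
    by rewrite /a1 hp mul0r.
  rewrite row_inr // /r1 hp; case/andP: hp => s1 s2.
  have := yr p.1; have := yr p.2; rewrite !splitE.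
  have := leS p.1; have := leS p.2; rewrite (gtr0_norm s1) (ltr0_norm s2) invrN.
  set A1 := \sum_(j < n) c p.1 j * _; set A2 := \sum_(j < n) c p.2 j * _.
  set t := y ord0; set w1 := (s p.1)^-1; set w2 := (s p.2)^-1 => S2 S1 h2 h1.
  have w1p : 0 <= w1 by rewrite invr_ge0 ltW.
  have w2n : 0 <= - w2 by rewrite oppr_ge0 invr_le0 ltW.
  have E1 : w1 * s p.1 = 1 by rewrite mulVf // gt_eqF.
  have E2 : w2 * s p.2 = 1 by rewrite mulVf // lt_eqF.
  have := ler_wpM2l w1p h1; have := ler_wpM2l w2n h2.
  have := ler_wpM2r e0 S1; have := ler_wpM2r e0 S2.
  rewrite !mulrDr !mulrA E1 !mulNr E2; lra.
exists (k1 + k2); first exact: addr_ge0.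
move=> r y e e0 [z zr] yr.
have [|||u' [u'r u'y]] := hK1 (r1 r) (fun j => y (lift ord0 j)) ((1 + 2 * S) * e).
- by rewrite mulr_ge0 //; lra.
- exists (fun j => z (lift ord0 j)) => q.
  (* With slack 0 this says that elimination preserves feasibility. *)
  by have := @elim_slack r z 0 q (lexx _); rewrite mulr0 addr0; apply=> i;
    rewrite addr0.
- by move=> q; apply: elim_slack.
have {}u'y j : `|u' j - y (lift ord0 j)| <= k1 * e by rewrite -mulrA.
(* Row [i] at [u'] is the one-variable constraint [s i * t <= rho i]. *)
pose rho i := r i - \sum_(j < n) c i j * u' j.
have near i : s i * y ord0 <= rho i + (1 + M * k1) * e.
  have ck : `|\sum_(j < n) c i j * (u' j - y (lift ord0 j))| <= M * (k1 * e).
    apply: le_trans (sum_mul_le _ u'y) _.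
    by apply: ler_wpM2r => //; rewrite mulr_ge0.
  have := yr i; rewrite splitE; move: ck; rewrite /rho.
  under eq_bigr do rewrite mulrBr.
  by rewrite sumrB ler_norml => /andP[]; lra.
have scale i : `|s i|^-1 * ((1 + M * k1) * e) <= k2 * e.
  by rewrite /k2 -mulrA; apply: ler_wpM2r => //; rewrite mulr_ge0 // addr_ge0 // mulr_ge0.
have [||||t' [t'hi t'lo t'y]] := @between_finite_bounds R I
    (fun i => 0 < s i) (fun k => s k < 0)
    (fun k => (s k)^-1 * rho k) (fun i => (s i)^-1 * rho i) (y ord0) (k2 * e).
- by rewrite mulr_ge0.
- move=> i k si sk.
  have hp : up_lo (i, k) by rewrite /up_lo si.
  by have := u'r (inr (i, k)); rewrite row_inr // /r1 hp /rho /=; lra.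
- move=> i si; have := scale i; have := near i; rewrite gtr0_norm //.
  have w0 : 0 <= (s i)^-1 by rewrite invr_ge0 ltW.
  by move=> /(ler_wpM2l w0); rewrite mulKf ?gt_eqF // mulrDr; lra.
- move=> k sk; have := scale k; have := near k; rewrite ltr0_norm // invrN.
  have w0 : 0 <= - (s k)^-1 by rewrite oppr_ge0 invr_le0 ltW.
  by move=> /(ler_wpM2l w0); rewrite mulNr mulKf ?lt_eqF // mulrDr; lra.
exists (fun j => if unlift ord0 j is Some k then u' k else t'); split; last first.
  move=> j; rewrite mulrDl; case: unliftP => [k ->|->].
    by apply: le_trans (u'y k) _; rewrite lerDl mulr_ge0.
  by apply: le_trans t'y _; rewrite lerDr mulr_ge0.
move=> i; rewrite splitE unlift_none.
under eq_bigr do rewrite liftK.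
rewrite -lerBrDr -/(rho i).
have [si|si|si] := ltrgtP (s i) 0.
- by rewrite -ler_ndivrMl // t'lo.
- by rewrite -ler_pdivlMl // t'hi.
- by have := u'r (inl i); rewrite row_inl // /r1 si eqxx mul0r subr_ge0.
Qed.

(** * Lipschitz continuity of the quadratic objective on a box *)

Lemma sum_row_le_sum (R : realFieldType) (m n : nat) (A : 'M[R]_(m, n)) (i : 'I_m) :
  \sum_j `|A i j| <= \sum_i \sum_j `|A i j|.
Proof.
rewrite [leRHS](bigD1 i) //= lerDl; apply: sumr_ge0 => k _.
exact: sumr_ge0.
Qed.

Lemma norm_mulmx_le (R : realFieldType) (m n : nat) (A : 'M[R]_(m, n))
    (u : 'cV[R]_n) (e : R) (i : 'I_m) :
  0 <= e -> (forall j, `|u j 0| <= e) ->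
  `|(A *m u) i 0| <= (\sum_i \sum_j `|A i j|) * e.
Proof.
move=> e0 ue; rewrite mxE; apply: le_trans (sum_mul_le _ ue) _.
by apply: ler_wpM2r => //; exact: sum_row_le_sum.
Qed.

Lemma norm_bilinear_le (R : realFieldType) (n : nat) (G : 'M[R]_n)
    (u v : 'cV[R]_n) (a c : R) :
  0 <= c -> (forall j, `|u j 0| <= a) -> (forall j, `|v j 0| <= c) ->
  `|(u^T *m G *m v) 0 0| <= n%:R * (\sum_i \sum_j `|G i j|) * (a * c).
Proof.
move=> c0 ua vc; have Gv k := norm_mulmx_le G k c0 vc.
rewrite -mulmxA mxE; apply: le_trans (sum_mul_le _ Gv) _.
have Gc : 0 <= (\sum_i \sum_j `|G i j|) * c.
  by rewrite mulr_ge0 //; do 2!apply: sumr_ge0 => ? _.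
have -> : n%:R * (\sum_i \sum_j `|G i j|) * (a * c) =
          (n%:R * a) * ((\sum_i \sum_j `|G i j|) * c) by ring.
apply: ler_wpM2r => //.
have -> : n%:R * a = \sum_(j < n) a by rewrite sumr_const card_ord mulr_natl.
by apply: ler_sum => j _; rewrite mxE.
Qed.

(** With [h := y' - y], the difference of the quadratic parts is
    [h^T G y' + y^T G h], linear in [h] with bounded coefficients. *)
Lemma lower_objective_lipschitz (R : realType) (n : nat)
    (G : 'M[R]_n) (d yl yu : 'cV[R]_n) :
  exists2 K : R, 0 <= K & forall (y y' : 'cV[R]_n) (e : R), 0 <= e ->
    box yl yu y -> box yl yu y' -> (forall j, `|y' j 0 - y j 0| <= e) ->
    `|lower_objective G d y' - lower_objective G d y| <= K * e.
Proof.
pose B := \sum_j (`|yl j 0| + `|yu j 0|).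
have B_ge0 : 0 <= B by apply: sumr_ge0 => j _; rewrite addr_ge0.
have boxB y j : box yl yu y -> `|y j 0| <= B.
  move=> [/(_ j) yly /(_ j) yyu].
  apply: (@le_trans _ _ (`|yl j 0| + `|yu j 0|)).
    have := ler_norm (yu j 0); have := ler_norm (- yl j 0).
    have := normr_ge0 (yu j 0); have := normr_ge0 (yl j 0).
    by rewrite normrN ler_norml; lra.
  by rewrite /B (bigD1 j) //= lerDl; apply: sumr_ge0 => k _; rewrite addr_ge0.
pose g := n%:R * \sum_i \sum_j `|G i j|.
pose dl := \sum_i \sum_j `|d^T i j|.
have g_ge0 : 0 <= g.
  by rewrite mulr_ge0 //; do 2!apply: sumr_ge0 => ? _.
have dl_ge0 : 0 <= dl by do 2!apply: sumr_ge0 => ? _.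
exists (g * B + dl).
  by rewrite addr_ge0 // mulr_ge0.
move=> y y' e e0 yB y'B yy'.
pose h := y' - y.
have he j : `|h j 0| <= e by rewrite !mxE.
have -> : lower_objective G d y' - lower_objective G d y =
    2^-1 * ((h^T *m G *m y') 0 0 + (y^T *m G *m h) 0 0) + (d^T *m h) 0 0.
  have entryB (A1 A2 : 'M[R]_1) : (A1 - A2) 0 0 = A1 0 0 - A2 0 0.
    by rewrite !mxE.
  rewrite /lower_objective /h [(_ - _)^T]linearB /= !mulmxBl !mulmxBr !entryB.
  by ring.
have := norm_bilinear_le G B_ge0 he (fun j => boxB _ j y'B).
have := norm_bilinear_le G e0 (fun j => boxB _ j yB) he.
have := norm_mulmx_le d^T 0 e0 he.
rewrite -/g -/dl; set t1 := (d^T *m h) 0 0; set t2 := (y^T *m G *m h) 0 0.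
set t3 := (h^T *m G *m y') 0 0.
by rewrite !ler_norml => /andP[? ?] /andP[? ?] /andP[? ?]; apply/andP; lra.
Qed.

(** * Lipschitz continuity of the feasible set and of the optimal value *)

Lemma norm_coord_le_enorm (R : realType) (n : nat) (u : 'cV[R]_n) (j : 'I_n) :
  `|u j 0| <= enorm u.
Proof.
rewrite -sqrtr_sqr /enorm; apply: ler_wsqrtr.
by rewrite (bigD1 j) //= lerDl; apply: sumr_ge0 => i _; exact: sqr_ge0.
Qed.

(** A point feasible for [x] violates the constraints for [x'] by at most
    [C *m (x' - x)] entrywise, so Hoffman's bound applies to the system that
    stacks the rows of [D] and the two sides of the box. *)
Lemma lower_feasible_lipschitz (R : realType) (ml nx ny : nat)
    (C : 'M[R]_(ml, nx)) (D : 'M[R]_(ml, ny)) (b : 'cV[R]_ml)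
    (yl yu : 'cV[R]_ny) :
  exists2 K : R, 0 <= K & forall (x x' : 'cV[R]_nx) (y : 'cV[R]_ny),
    lower_feasible C D b yl yu x' !=set0 -> lower_feasible C D b yl yu x y ->
    exists y' : 'cV[R]_ny, lower_feasible C D b yl yu x' y' /\
      forall j, `|y' j 0 - y j 0| <= K * enorm (x' - x).
Proof.
pose a (q : 'I_ml + ('I_ny + 'I_ny)) (j : 'I_ny) : R := match q with
  | inl i => D i j
  | inr (inl k) => - (k == j)%:R
  | inr (inr k) => (k == j)%:R
  end.
pose r (x : 'cV[R]_nx) (q : 'I_ml + ('I_ny + 'I_ny)) : R := match q with
  | inl i => b i 0 - (C *m x) i 0
  | inr (inl k) => - yl k 0
  | inr (inr k) => yu k 0
  end.
have sum_delta k (z : 'I_ny -> R) : \sum_(j < ny) (k == j)%:R * z j = z k.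
  rewrite (bigD1 k) //= eqxx mul1r big1 ?addr0 // => j /negbTE.
  by rewrite eq_sym => ->; rewrite mul0r.
have feasP x (z : 'I_ny -> R) : (forall q, \sum_(j < ny) a q j * z j <= r x q) <->
    lower_feasible C D b yl yu x (\col_j z j).
  have Dz i : (C *m x + D *m \col_j z j) i 0 =
      (C *m x) i 0 + \sum_(j < ny) D i j * z j.
    rewrite [LHS]mxE; congr (_ + _); rewrite mxE.
    by apply: eq_bigr => j _; rewrite mxE.
  split=> [zr|[zD [zl zu]] [i|[k|k]] /=].
  - split=> [i|]; first by have := zr (inl i); rewrite Dz /=; lra.
    split=> k; rewrite mxE; last by have := zr (inr (inr k)); rewrite /= sum_delta.
    have := zr (inr (inl k)); rewrite /=.
    by under eq_bigr do rewrite mulNr; rewrite sumrN sum_delta lerN2.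
  - by have := zD i; rewrite Dz; lra.
  - under eq_bigr do rewrite mulNr.
    by rewrite sumrN sum_delta lerN2; have := zl k; rewrite mxE.
  - by rewrite sum_delta; have := zu k; rewrite mxE.
have [K K_ge0 hK] := hoffman_bound a.
pose c := \sum_i \sum_j `|C i j|.
have c_ge0 : 0 <= c by do 2!apply: sumr_ge0 => ? _.
exists (K * c); first by rewrite mulr_ge0.
have colE (u : 'cV[R]_ny) : u = \col_j u j 0.
  by apply/matrixP => i j; rewrite !mxE ord1.
move=> x x' y [z zF] yF.
have n_ge0 : 0 <= enorm (x' - x) by exact: sqrtr_ge0.
have cn_ge0 : 0 <= c * enorm (x' - x) by rewrite mulr_ge0.
have [||y' [y'r y'y]] :=
    hK (r x') (fun j => y j 0) (c * enorm (x' - x)) cn_ge0.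
- by exists (fun j => z j 0); apply/feasP; rewrite -colE.
- have yr : forall q, \sum_(j < ny) a q j * y j 0 <= r x q.
    by apply/feasP; rewrite -colE.
  case=> [i|k]; last by apply: le_trans (yr (inr k)) _; case: k => k; rewrite lerDl.
  apply: le_trans (yr (inl i)) _ => /=.
  have := norm_mulmx_le C i n_ge0 (norm_coord_le_enorm (x' - x)).
  have -> : (C *m (x' - x)) i 0 = (C *m x') i 0 - (C *m x) i 0.
    by rewrite mulmxBr mxE [X in _ + X]mxE.
  by rewrite -/c ler_norml => /andP[_]; lra.
exists (\col_j y' j); split; first exact/feasP.
by move=> j; rewrite mxE -mulrA.
Qed.

Theorem theorem4p2 (R : realType) (ml nx ny : nat)
    (C : 'M[R]_(ml, nx)) (D : 'M[R]_(ml, ny)) (b : 'cV[R]_ml)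
    (dl : 'cV[R]_ny) (Gl : 'M[R]_ny)
    (xl xu : 'cV[R]_nx) (yl yu : 'cV[R]_ny)
    (Gl_sym : Gl^T = Gl) (xl_le_xu : vle xl xu) (yl_le_yu : vle yl yu)
    (T_nonempty : forall x : 'cV[R]_nx,
       box xl xu x -> Tset C D b yl yu x !=set0) :
  exists L : R, 0 < L /\
    forall x x' : 'cV[R]_nx, box xl xu x -> box xl xu x' ->
      `|phi C D b Gl dl yl yu x' - phi C D b Gl dl yl yu x| <= L * enorm (x' - x).
Proof.
have [K K_ge0 hK] := lower_feasible_lipschitz C D b yl yu.
have [M M_ge0 hM] := lower_objective_lipschitz Gl dl yl yu.
(* [M * K] may vanish, and [L] must be positive. *)
exists (M * K + 1); split; first by rewrite ltr_wpDl // mulr_ge0.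
(* The minimizer for [x], moved into the feasible set of [x'], is a competitor
   for the minimum at [x']. *)
have one_sided (x x' : 'cV[R]_nx) : box xl xu x -> box xl xu x' ->
    phi C D b Gl dl yl yu x' - phi C D b Gl dl yl yu x <= (M * K) * enorm (x' - x).
  move=> xB x'B; have n_ge0 : 0 <= enorm (x' - x) by exact: sqrtr_ge0.
  have [[y yF <-] _] := phi_is_minimum Gl dl (T_nonempty x xB).
  have [_ lb] := phi_is_minimum Gl dl (T_nonempty x' x'B).
  have [|y' [y'F y'y]] := hK x x' y _ yF.
    by rewrite -TsetE; exact: T_nonempty.
  have Kn_ge0 : 0 <= K * enorm (x' - x) by rewrite mulr_ge0.
  have := hM y y' _ Kn_ge0 (proj2 yF) (proj2 y'F) y'y.
  have := lb _ (imageP (lower_objective Gl dl) y'F).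
  by rewrite ler_norml -mulrA => ? /andP[_]; lra.
move=> x x' xB x'B.
have n_ge0 : 0 <= enorm (x' - x) by exact: sqrtr_ge0.
have enorm_sym : enorm (x - x') = enorm (x' - x).
  by rewrite /enorm; congr Num.sqrt; apply: eq_bigr => i _; rewrite !mxE -sqrrN opprB.
have := one_sided x x' xB x'B; have := one_sided x' x x'B xB.
by rewrite enorm_sym ler_norml; lra.
Qed.
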